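(* Let $F$ be a field of characteristic $3$, let $\lambda\in F$, and let $S=\overline{B(1,2)}_\lambda$ be the symmetric composition superalgebra described in the context. $\bullet$ If $\lambda=0$, the nontrivial gradings on the superalgebra $S$ are the nontrivial gradings on the superalgebra $B(1,2)$, with the same classifications up to equivalence and up to isomorphism. That is, up to equivalence they are the $\mathbb{Z}$-grading with $S^0=F1$, $S^1=Fu$, $S^{-1}=Fv$ (where $\{u,v\}$ is a basis of $V$ with $(u,v)=1$) and the main $\mathbb{Z}_2$-grading; and for an abelian group $G$, every $G$-grading on $S$ is isomorphic to the grading $\Gamma(G,g)$ with $\deg(1)=0$, $\deg(u)=g$, $\deg(v)=-g$ for some $g\in G$, with $\Gamma(G,g)\cong\Gamma(G,h)$ if and only if $g=h$ or $g=-h$. $\bullet$ If $\lambda\neq0$, the only nontrivial grading on the superalgebra $S$ up to equivalence is the main $\mathbb{Z}_2$-grading. In this case, two such gradings (nontrivial gradings by the same group) are isomorphic if and only if they have the same support.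
   Context: Gradings. A grading by a group $G$ on an algebra $\mathcal A$ is a decomposition $\mathcal A=\bigoplus_{g\in G}\mathcal A^g$ into subspaces with $\mathcal A^g\mathcal A^h\subseteq\mathcal A^{gh}$; its support is $\{g:\mathcal A^g\ne0\}$. A superalgebra is a $\mathbb{Z}_2$-graded algebra $\mathcal A=\mathcal A_{\bar0}\oplus\mathcal A_{\bar1}$ (the main grading). A grading on the superalgebra $\mathcal A$ is a group grading on the algebra $\mathcal A$ such that $\mathcal A^g=(\mathcal A^g\cap\mathcal A_{\bar0})\oplus(\mathcal A^g\cap\mathcal A_{\bar1})$ for all $g$. The trivial grading is $\mathcal A=\mathcal A^e$. Two gradings are equivalent if there is an isomorphism of superalgebras (preserving the main grading) mapping each nonzero homogeneous component of the first onto a homogeneous component of the second; two gradings by the same group $G$ are isomorphic ($\cong$) if there is an isomorphism of superalgebras mapping the component of degree $g$ onto the component of degree $g$ for every $g\in G$. Only abelian groups are considered. The superalgebra $B(1,2)$. Let $V$ be a $2$-dimensional vector space over a field $F$ of characteristic $3$ with a nondegenerate alternating form $(\cdot,\cdot)$. Then $B(1,2)=F1\oplus V$, with even part $F1$, odd part $V$, and multiplication $1\cdot x=x\cdot1=x$ and $u\cdot v=(u,v)1$ for $u,v\in V$. Its canonical involution is $\bar1=1$, $\bar w=-w$ for $w\in V$. The superalgebra $\overline{B(1,2)}_\lambda$. Given $\lambda\in F$ and a basis $\{u,v\}$ of $V$ with $(u,v)=1$, let $\varphi$ be the automorphism of $B(1,2)$ with $\varphi(1)=1$, $\varphi(u)=u$,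 $\varphi(v)=\lambda u+v$ (so $\varphi^3=1$). Then $\overline{B(1,2)}_\lambda$ is the vector space $B(1,2)$ with the same even and odd parts and the product $x*y=\varphi(\bar x)\cdot\varphi^2(\bar y)$. *)

(* Defs.v *)
From HB Require Import structures.
From mathcomp Require Import all_boot all_order all_algebra.
From mathcomp Require Import sesquilinear.

Set Implicit Arguments.
Unset Strict Implicit.
Unset Printing Implicit Defensive.

Import GRing.Theory.
Local Open Scope ring_scope.

Section Gradings.

Variables (F : fieldType) (A : vectType F).

(* Gradings by an arbitrary, possibly infinite, abelian group G, written
   additively.  The first two conditions say that A is the direct sum of the
   [Gam g]: every vector lies in a finite partial sum, and every finite partial
   sum is direct. *)
Definition is_grading (mul : A -> A -> A) (G : zmodType)
    (Gam : G -> {vspace A}) : Prop :=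
  [/\ forall x : A, exists s : seq G, x \in (\sum_(g <- s) Gam g)%VS,
      forall s : seq G, uniq s -> directv (\sum_(g <- s) Gam g)
    & forall (g h : G) (x y : A),
        x \in Gam g -> y \in Gam h -> mul x y \in Gam (g + h)].

Definition same_support (G : zmodType) (Gam Del : G -> {vspace A}) : Prop :=
  forall g : G, Gam g != 0%VS <-> Del g != 0%VS.

(* Not necessarily associative nor unital; [main_grading] is the Z_2-grading
   that makes the algebra a superalgebra. *)
Record superalgebra := Superalgebra {
  samul :> {bilinear A -> A -> A};
  main_grading : 'Z_2 -> {vspace A};
  main_gradingP : is_grading samul main_grading
}.

(* The sum below is automatically direct. *)
Definition super_grading (S : superalgebra) (G : zmodType)
    (Gam : G -> {vspace A}) : Prop :=
  is_grading S Gam /\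
  forall g : G, Gam g = (Gam g :&: main_grading S 0%R +
                         Gam g :&: main_grading S 1%R)%VS.

Definition nontrivial_grading (S : superalgebra) (G : zmodType)
    (Gam : G -> {vspace A}) : Prop :=
  super_grading S Gam /\ Gam 0 <> fullv.

End Gradings.

Definition super_iso (F : fieldType) (A B : vectType F)
    (S : superalgebra A) (T : superalgebra B) (f : 'Hom(A, B)) : Prop :=
  [/\ bijective f,
      forall x y : A, f (S x y) = T (f x) (f y)
    & forall i : 'Z_2, (f @: main_grading S i)%VS = main_grading T i].

Definition equivalent_gradings (F : fieldType) (A B : vectType F)
    (S : superalgebra A) (G : zmodType) (Gam : G -> {vspace A})
    (T : superalgebra B) (H : zmodType) (Del : H -> {vspace B}) : Prop :=
  exists2 f : 'Hom(A, B), super_iso S T f &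
    forall g : G, Gam g != 0%VS -> exists h : H, (f @: Gam g)%VS = Del h.

Definition isomorphic_gradings (F : fieldType) (A B : vectType F)
    (G : zmodType)
    (S : superalgebra A) (Gam : G -> {vspace A})
    (T : superalgebra B) (Del : G -> {vspace B}) : Prop :=
  exists2 f : 'Hom(A, B), super_iso S T f &
    forall g : G, (f @: Gam g)%VS = Del g.

Definition alternating (F : fieldType) (V : vectType F) (b : V -> V -> F) :=
  forall x : V, b x x = 0.

Definition nondegenerate_form (F : fieldType) (V : vectType F)
    (b : V -> V -> F) :=
  forall x : V, (forall y : V, b x y = 0) -> x = 0.

(* [(a, w) : B12_space V] stands for a1 + w in F1 (+) V. *)
Definition B12_space (F : fieldType) (V : vectType F) : vectType F :=
  (F^o * V)%type.

Section B12.

Variables (F : fieldType) (V : vectType F).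

Local Notation B := (B12_space V).

Definition B12_one : B := (1, 0).

Definition B12_inj (w : V) : B := (0, w).

Fact B12_inj_is_linear : linear B12_inj.
Proof. by move=> a x y; congr pair; rewrite /= ?scaler0 ?addr0. Qed.

HB.instance Definition _ :=
  GRing.isLinear.Build F V B _ B12_inj B12_inj_is_linear.

Definition B12_part (i : 'Z_2) : {vspace B} :=
  if i == 0 then <[B12_one]>%VS else limg (linfun B12_inj).

Definition B12_bar (x : B) : B := (x.1, - x.2).

Variable b : {biscalar V}.

Definition B12_mul (x y : B) : B :=
  (x.1 * y.1 + b x.2 y.2, x.1 *: y.2 + y.1 *: x.2).

Variables (u v : V) (lam : F).

(* The linear map fixing 1 and u and sending v to lam u + v, for a basis
   (u, v) of V: [coord [tuple u; v] i w] is the i-th coordinate of w. *)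
Definition B12_phi (x : B) : B :=
  let c := fun i : 'I_2 => coord [tuple u; v] i x.2 in
  (x.1, c 0 *: u + c 1 *: (lam *: u + v)).

Definition B12bar_mul (x y : B) : B :=
  B12_mul (B12_phi (B12_bar x)) (B12_phi (B12_phi (B12_bar y))).

Fact B12_bar_is_linear : linear B12_bar.
Proof. by move=> a x y; congr pair; rewrite /= opprD scalerN. Qed.

HB.instance Definition _ :=
  GRing.isLinear.Build F B B _ B12_bar B12_bar_is_linear.

Fact B12_phi_is_linear : linear B12_phi.
Proof.
move=> a x y; congr pair => /=.
rewrite 2!(linearP (coord _ _)); move: (lam *: u + v) => w.
by rewrite !scalerDl -!scalerA scalerDr addrACA.
Qed.

HB.instance Definition _ :=
  GRing.isLinear.Build F B B _ B12_phi B12_phi_is_linear.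

Fact B12_mul_is_bilinear : bilinear_for *:%R *:%R B12_mul.
Proof.
split=> z a x y; congr pair => /=.
- rewrite linearPl /= mulrDl scalerDr addrACA; congr (_ + _ + _).
  by rewrite /GRing.scale /= mulrA.
- rewrite scalerDl !scalerDr !scalerA addrACA.
  by congr (_ + _ + _); rewrite mulrC.
- rewrite linearPr /= mulrDr scalerDr addrACA; congr (_ + _ + _).
  by rewrite /GRing.scale /= mulrCA.
- rewrite scalerDl !scalerDr !scalerA addrACA.
  by congr (_ + _ + _); rewrite mulrC.
Qed.

HB.instance Definition _ :=
  bilinear_isBilinear.Build F B B B _ _ B12_mul B12_mul_is_bilinear.

Fact B12bar_mul_is_bilinear : bilinear_for *:%R *:%R B12bar_mul.
Proof.
split=> z a x y; rewrite /B12bar_mul !linearP.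
  by rewrite linearPl.
by rewrite linearPr.
Qed.

HB.instance Definition _ :=
  bilinear_isBilinear.Build F B B B _ _ B12bar_mul B12bar_mul_is_bilinear.

Lemma mem_B12_part (i : 'Z_2) (x : B) :
  (x \in B12_part i) = (if i == 0 then x.2 == 0 else x.1 == 0).
Proof.
rewrite /B12_part; case: ifP => _.
  apply/vlineP/eqP => [[k ->]|]; first by rewrite /= scaler0.
  case: x => a w /= ->; exists a.
  by congr pair; rewrite /= ?scaler0 // /GRing.scale /= mulr1.
apply/memv_imgP/eqP => [[w _ ->]|]; first by rewrite lfunE.
by case: x => a w /= ->; exists w; rewrite ?memvf ?lfunE.
Qed.

Lemma Z2_cases (i : 'Z_2) : i = 0 \/ i = 1.
Proof.
by case: i => [[|[|//]] p]; [left|right]; apply: val_inj.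
Qed.

Lemma B12_part_grading (mul : B -> B -> B) :
  (forall (g h : 'Z_2) (x y : B), x \in B12_part g -> y \in B12_part h ->
     mul x y \in B12_part (g + h)) ->
  is_grading mul B12_part.
Proof.
move=> Hmul; split=> // [x|s Us].
  exists [:: 0; 1]; rewrite !big_cons big_nil addv0.
  have -> : x = (x.1, 0) + (0, x.2).
    by case: x => a w; congr pair; rewrite /= ?addr0 ?add0r.
  by apply: memv_add; rewrite mem_B12_part /=.
rewrite directvE /= !big_uniq //=.
suff : directv (\sum_(i in s) B12_part i) by rewrite directvE.
apply/directv_sumP => i _; apply/eqP; rewrite -subv0; apply/subvP => x.
rewrite memv_cap memv0 => /andP[xi xj].
have {xj} : x \in B12_part (i + 1).
  apply: subvP xj; apply/subv_sumP => j /andP[_].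
  by case: (Z2_cases i) => ->; case: (Z2_cases j) => ->.
move: xi; case: x => a w; rewrite !mem_B12_part.
by case: (Z2_cases i) => -> /= /eqP-> /eqP->.
Qed.

Fact B12_main_gradingP : is_grading B12_mul B12_part.
Proof.
apply: B12_part_grading => g h [a x] [c y]; rewrite !mem_B12_part.
case: (Z2_cases g) => ->; case: (Z2_cases h) => -> /= /eqP-> /eqP->;
by rewrite ?scaler0 ?scale0r ?mul0r ?mulr0 ?linear0l ?linear0r ?addr0.
Qed.

Lemma B12_phi_part (i : 'Z_2) (x : B) :
  x \in B12_part i -> B12_phi x \in B12_part i.
Proof.
rewrite !mem_B12_part; case: ifP => //= _ /eqP->.
by rewrite !linear0 !scale0r addr0.
Qed.

Lemma B12_bar_part (i : 'Z_2) (x : B) :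
  x \in B12_part i -> B12_bar x \in B12_part i.
Proof. by rewrite !mem_B12_part; case: ifP => //= _; rewrite oppr_eq0. Qed.

Fact B12bar_main_gradingP : is_grading B12bar_mul B12_part.
Proof.
apply: B12_part_grading => g h x y xg yh.
have [_ _] := B12_main_gradingP; apply; first exact/B12_phi_part/B12_bar_part.
exact/B12_phi_part/B12_phi_part/B12_bar_part.
Qed.

Definition B12 : superalgebra B := Superalgebra B12_main_gradingP.

Definition B12bar : superalgebra B := Superalgebra B12bar_main_gradingP.

Definition B12_Z_grading (n : int) : {vspace B} :=
  if n == 0 then <[B12_one]>%VS
  else if n == 1 then <[B12_inj u]>%VS
  else if n == -1 then <[B12_inj v]>%VS
  else 0%VS.

(* The grading Gamma(G, g); a sum, since 0, g and -g need not be distinct. *)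
Definition B12_Gamma (G : zmodType) (g : G) (h : G) : {vspace B} :=
  ((if h == 0%R then <[B12_one]> else 0) +
   (if h == g then <[B12_inj u]> else 0) +
   (if h == - g then <[B12_inj v]> else 0))%VS.

End B12.

(* Main.v *)
From HB Require Import structures.
Require Import Defs.
From mathcomp Require Import all_boot all_order all_algebra.
From mathcomp Require Import sesquilinear.

Set Implicit Arguments.
Unset Strict Implicit.
Unset Printing Implicit Defensive.

Import GRing.Theory.
Local Open Scope ring_scope.

(* In a grading of S the unit of B(1,2) is homogeneous (the even part is a line)
   and idempotent, so it has degree 0, and V is spanned by homogeneous vectors.
   If lam = 0, then S x y = B (bar x) (bar y) and bar fixes every graded
   subspace and commutes with every isomorphism, so S may be replaced by B; two
   homogeneous basis vectors x, y of V have b x y <> 0, hence opposite degrees,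
   and rescaling y gives Gamma(G, g) for the symplectic basis (x, y).
   If lam <> 0, left multiplication by 1 maps w in V to -(w + 2 lam c u), where
   c is the v-coordinate of w, and preserves every component.  A homogeneous w
   outside F u thus puts u, hence all of V, in the component of w, whose degree
   g satisfies 2 g = 0 because u * v = 1: the grading is Gamma(G, g) with
   g = -g. *)

(** * Homogeneous decompositions in an arbitrary group-graded algebra *)

Section GradingTheory.

Variables (F : fieldType) (A : vectType F).

(** Since [U k + U k = U k], all the summands indexed by [k] merge into a single vector [y], even
    when [s] repeats [k]; if [k] is absent, [y] is 0. *)
Lemma memv_big_sum (I : eqType) (s : seq I) (U : I -> {vspace A}) (x : A) :
  x \in (\sum_(i <- s) U i)%VS ->
  forall k, exists2 y, y \in U k &
    x - y \in (\sum_(i <- s | i != k) U i)%VS.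
Proof.
elim: s x => [|i s IHs] x.
  rewrite big_nil memv0 => /eqP-> k; exists 0; first exact: mem0v.
  by rewrite big_nil subr0 mem0v.
rewrite big_cons => /memv_addP[y yi [z zs ->]] k.
have [w wk zw] := IHs z zs k; rewrite big_cons.
have [ik|_] := eqVneq i k.
  exists (y + w); first by rewrite -ik in wk *; rewrite memvD.
  by rewrite opprD addrACA subrr add0r.
by exists w => //; rewrite -addrA memv_add.
Qed.

Variables (mul : A -> A -> A) (G : zmodType) (Gam : G -> {vspace A}).
Hypothesis gradG : is_grading mul Gam.

Lemma grading_mem_sum_eq0 (k : G) (s : seq G) (x : A) :
  x \in Gam k -> x \in (\sum_(i <- s | i != k) Gam i)%VS -> x = 0.
Proof.
move=> xk xs; have [_ dir _] := gradG.
(* Directness is only given for duplicate-free sequences, so the indices are deduplicated; comparing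
   dimensions for [k :: t] and [t] then makes the intersection zero. *)
pose t := undup [seq i <- s | i != k].
have xt : x \in (\sum_(i <- t) Gam i)%VS.
  by rewrite big_undup ?big_filter // => U; apply: addvv.
have := dir (k :: t).
rewrite /= undup_uniq mem_undup mem_filter eqxx => /(_ isT).
rewrite directvE /= !big_cons => /eqP dkt.
have dt : (\dim (\sum_(i <- t) Gam i) = \sum_(i <- t) \dim (Gam i))%N.
  by have := dir t (undup_uniq _); rewrite directvE => /eqP.
have := dimv_sum_cap (Gam k) (\sum_(i <- t) Gam i).
rewrite dkt dt -[RHS]addn0 => /eqP; rewrite eqn_add2l dimv_eq0 => /eqP cap0.
by apply/eqP; rewrite -memv0 -cap0 memv_cap xk.
Qed.

Lemma grading_degree_unique (g h : G) (x : A) :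
  x != 0 -> x \in Gam g -> x \in Gam h -> g = h.
Proof.
move=> x0 xg xh; apply/eqP; apply: contraNT x0 => gh.
apply/eqP/(grading_mem_sum_eq0 (s := [:: h]) xg).
by rewrite big_cons big_nil eq_sym gh addv0.
Qed.

(** For [x] in [Gam k], subtract its [Del k] part: the difference lies in [Gam k] and also in the
    sum of the other components of [Gam], so it vanishes. *)
Lemma grading_refine_eq mul' (Del : G -> {vspace A}) :
  is_grading mul' Del -> (forall k, (Del k <= Gam k)%VS) ->
  forall k, Del k = Gam k.
Proof.
move=> [spanD _ _] sub k; apply: subv_anti; rewrite sub; apply/subvP => x xk.
have [s /memv_big_sum/(_ k)[y yk xys]] := spanD x.
have -> // : x = y; apply/eqP; rewrite -subr_eq0; apply/eqP.
apply: (@grading_mem_sum_eq0 k s).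
  by rewrite memvB // (subvP (sub k)).
apply: subvP xys.
by apply: (big_ind2 (fun U W => U <= W)%VS) => // *; apply: addvS.
Qed.

(** If every component were inside [U], so would be every finite sum of components. This is the
    source of all homogeneous vectors used below. *)
Lemma grading_homogeneous_notin (U : {vspace A}) :
  U != fullv -> exists g x, x \in Gam g /\ x \notin U.
Proof.
move=> Ufull; have [spanG _ _] := gradG.
have/subvPn[z _ zU] : ~~ (fullv <= U)%VS.
  by apply: contra Ufull => fU; rewrite eqEsubv subvf.
have [s zs] := spanG z.
have/hasP[g _ /subvPn[x xg xU]] : has (fun g => ~~ (Gam g <= U)%VS) s.
  rewrite has_predC; apply: contra zU => /allP sU; apply: subvP zs.
  rewrite big_seq; apply: (big_ind (fun W => W <= U)%VS) => //.
    exact: sub0v.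
  by move=> W1 W2 W1U W2U; rewrite subv_add W1U.
by exists g, x.
Qed.

End GradingTheory.

(** * Superalgebra isomorphisms and pointwise equal gradings *)

Lemma limg_if (F : fieldType) (A A' : vectType F) (f : 'Hom(A, A')) (c : bool)
    (z : A) :
  (f @: (if c then <[z]> else 0) = if c then <[f z]> else 0)%VS.
Proof. by case: c; [apply: limg_line | apply: limg0]. Qed.

Lemma super_iso_id (F : fieldType) (A : vectType F) (S : superalgebra A) :
  super_iso S S \1%VF.
Proof.
split=> [|x y|i]; first by exists id => x; rewrite id_lfunE.
  by rewrite !id_lfunE.
exact: lim1g.
Qed.

Lemma lker_super_iso (F : fieldType) (A A' : vectType F)
    (S : superalgebra A) (T : superalgebra A') (f : 'Hom(A, A')) :
  super_iso S T f -> lker f == 0%VS.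
Proof. by case=> /bij_inj/lker0P. Qed.

Section Extensionality.

Variables (F : fieldType) (A : vectType F) (S : superalgebra A) (G : zmodType).
Variables Gam Del : G -> {vspace A}.
Hypothesis eqGD : forall k, Gam k = Del k.

Lemma eq_super_grading : super_grading S Gam -> super_grading S Del.
Proof.
have sumE (s : seq G) : (\sum_(k <- s) Gam k = \sum_(k <- s) Del k)%VS.
  by apply: eq_bigr.
case=> [[spanG dirG mulG] splitG]; split=> [|k]; last by rewrite -eqGD -splitG.
split=> [x | s /dirG | g h x y]; last by rewrite -!eqGD; apply: mulG.
  by have [s] := spanG x; exists s; rewrite -sumE.
rewrite !directvE /= sumE => /eqP->; apply/eqP.
by apply: eq_bigr => k _; rewrite eqGD.
Qed.

Lemma eq_isomorphic_gradings : isomorphic_gradings S Gam S Del.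
Proof.
by exists \1%VF => [|k]; [apply: super_iso_id | rewrite lim1g].
Qed.

End Extensionality.

(** * Coordinates in a basis of the plane V *)

Section Coordinates.

Variables (F : fieldType) (V : vectType F) (x y : V).
Hypothesis xy_basis : basis_of {:V} [:: x; y].

Definition coordl := coord [tuple x; y] 0.
Definition coordr := coord [tuple x; y] 1.

Lemma coord2E (w : V) : w = coordl w *: x + coordr w *: y.
Proof.
rewrite [LHS](coord_basis (X := [tuple x; y]) xy_basis (memvf w)).
rewrite big_ord_recl big_ord1 /=.
by congr (_ + coord _ _ _ *: _); apply: val_inj.
Qed.

Lemma coord2_free (s t : F) :
  (coordl (s *: x + t *: y) = s) * (coordr (s *: x + t *: y) = t).
Proof.
have X := basis_free xy_basis.
have cxy (i j : 'I_2) : coord [tuple x; y] j [tuple x; y]`_i = (i == j)%:R.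
  exact: coord_free.
rewrite /coordl /coordr !linearD !linearZ /=.
by rewrite (cxy 0 0) (cxy 1 0) (cxy 0 1) (cxy 1 1) !mulr0 !mulr1 addr0 add0r.
Qed.

Lemma coord2_fst : (coordl x = 1) * (coordr x = 0).
Proof.
by have := coord2_free 1 0; rewrite scale1r scale0r addr0 => -[-> ->].
Qed.

Lemma coord2_snd : (coordl y = 0) * (coordr y = 1).
Proof.
by have := coord2_free 0 1; rewrite scale1r scale0r add0r => -[-> ->].
Qed.

End Coordinates.

(** * Subspaces of F1 + V compatible with parity, and the components of Gamma(G, g) *)

Section Space.

Variables (F : fieldType) (V : vectType F).
Local Notation B := (B12_space V).

(** Closure under the even projection suffices, because the odd part [z - (z.1, 0)] then lies in [U]
    as well. *)
Lemma super_subspaceP (U : {vspace B}) :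
  U = (U :&: B12_part V 0%R + U :&: B12_part V 1%R)%VS <->
  forall z, z \in U -> (z.1, 0) \in U.
Proof.
split=> [UE z | U0].
  rewrite {1}UE => /memv_addP[p + [q + ->]].
  rewrite !memv_cap !mem_B12_part /= => /andP[pU /eqP p2] /andP[_ /eqP->].
  by rewrite addr0 -p2; case: p pU {p2}.
apply: subv_anti; rewrite subv_add !capvSl !andbT; apply/subvP=> z zU.
have -> : z = (z.1, 0) + (z - (z.1, 0)) by rewrite subrKC.
have z1U := U0 _ zU.
rewrite memv_add // memv_cap mem_B12_part /= ?z1U ?eqxx //.
by rewrite memvB //= subrr eqxx.
Qed.

Section Gamma.

Variables (x y : V) (xy_basis : basis_of {:V} [:: x; y]) (G : zmodType).

(** Each of the three coordinates of [z] may be nonzero only in its own degree. This form holds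
    uniformly when some of 0, g and -g coincide. *)
Lemma mem_B12_Gamma (g k : G) (z : B) :
  (z \in B12_Gamma x y g k) =
  [&& (k == 0) || (z.1 == 0), (k == g) || (coordl x y z.2 == 0)
    & (k == - g) || (coordr x y z.2 == 0)].
Proof.
have mem_if (c : bool) (w t : B) : t \in <[w]>%VS ->
    (t \in (if c then <[w]> else 0)%VS) = c || (t == 0).
  by case: c => // _; rewrite memv0.
have if_mem (c : bool) (w t : B) : t \in (if c then <[w]> else 0)%VS ->
    exists2 a, t = a *: w & c || (a == 0).
  case: c => [/vlineP[a ->]|]; first by exists a.
  by rewrite memv0 => /eqP->; exists 0; rewrite ?scale0r ?eqxx.
apply/memv_addP/and3P.
  case=> _ /memv_addP[_ /if_mem[a -> ha] [_ /if_mem[s -> hs] ->]].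
  case=> _ /if_mem[t -> ht] ->; rewrite /= !scaler0 !addr0 add0r.
  by rewrite !(coord2_free xy_basis) [_%:A]mulr1.
move=> [ha hs ht]; exists (z.1 *: B12_one V + coordl x y z.2 *: B12_inj x).
  apply: memv_add.
    case: ifP ha => _ //=; first by rewrite memvZ ?memv_line.
    by move=> /eqP->; rewrite scale0r mem0v.
  case: ifP hs => _ //=; first by rewrite memvZ ?memv_line.
  by move=> /eqP->; rewrite scale0r mem0v.
exists (coordr x y z.2 *: B12_inj y).
  case: ifP ht => _ //=; first by rewrite memvZ ?memv_line.
  by move=> /eqP->; rewrite scale0r mem0v.
case: z {ha hs ht} => a w; congr pair => /=.
  by rewrite !scaler0 !addr0 [_%:A]mulr1.
by rewrite scaler0 add0r -coord2E.
Qed.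

End Gamma.

End Space.

Lemma orb_addr_eq0 (V : zmodType) (c d : bool) (s t : V) :
  c || (s == 0) -> d || (t == 0) -> (c || d) || (s + t == 0).
Proof. by case: c => //=; case: d => //= /eqP-> /eqP->; rewrite addr0. Qed.

(** * Alternating forms on the plane, and Gamma(G, g) as a grading on B(1,2) *)

Section Form.

Variables (F : fieldType) (V : vectType F) (b : {biscalar V}).
Hypothesis b_alt : alternating b.

Lemma alternating_anti (x y : V) : b y x = - b x y.
Proof.
have := b_alt (x + y); rewrite linearDl !linearDr !b_alt add0r addr0 addrC.
by move/eqP; rewrite addr_eq0 => /eqP.
Qed.

(** Up to the factor [b x y], an alternating form on a plane is the determinant of the
    coordinates. *)
Lemma alternating_coord (x y w t : V) : basis_of {:V} [:: x; y] ->
  b w t = (coordl x y w * coordr x y t - coordr x y w * coordl x y t) * b x y.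
Proof.
move=> xy; rewrite [w in LHS](coord2E xy) [t in LHS](coord2E xy).
rewrite linearDl !linearDr !linearZl_LR !linearZr_LR /= !b_alt.
by rewrite (alternating_anti x y) !mulr0 add0r addr0 !mulrN mulrBl !mulrA.
Qed.

Lemma B12_1l (x : B12_space V) : B12_mul b (B12_one V) x = x.
Proof.
case: x => a w.
by congr pair; rewrite /= ?linear0l ?scaler0 ?mul1r ?scale1r addr0.
Qed.

Variables (x y : V) (xy_basis : basis_of {:V} [:: x; y]).

Lemma B12_Gamma_super (G : zmodType) (g : G) :
  super_grading (B12 b) (B12_Gamma x y g).
Proof.
split; last first.
  move=> k; apply/super_subspaceP => z; rewrite !(mem_B12_Gamma xy_basis) /=.
  by case/and3P=> -> _ _; rewrite /coordl /coordr !linear0 !eqxx !orbT.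
split=> [z | s Us | h k p q].
- exists [:: 0; g; - g]; rewrite !big_cons big_nil addv0.
  have -> : z = (z.1, 0) + ((0, coordl x y z.2 *: x) +
                            (0, coordr x y z.2 *: y)).
    by case: z => a w; congr pair; rewrite /= ?addr0 // add0r -coord2E.
  have cl s t := (coord2_free xy_basis s t).1.
  have cr s t := (coord2_free xy_basis s t).2.
  rewrite !memv_add // (mem_B12_Gamma xy_basis) /= ?eqxx ?orbT //=.
  + by rewrite /coordl /coordr !linear0 !eqxx !orbT.
  + by rewrite -[_ *: x]addr0 -(scale0r y) cr eqxx orbT.
  + by rewrite -[_ *: y]add0r -(scale0r x) cl eqxx orbT.
(* A vector shared by the component of a new degree [k] and the sum over [s] has each coordinate
   supported both at [k] and inside [s]; as [k] is not in [s], all of them vanish. *)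
- elim: s Us => [|k s IHs] /=; first by rewrite directvE /= !big_nil dimv0.
  case/andP=> ks /IHs; rewrite !directvE /= !big_cons => /eqP <-.
  apply/eqP/dimv_disjoint_sum/eqP; rewrite -subv0; apply/subvP => z.
  rewrite memv_cap memv0 (mem_B12_Gamma xy_basis) => /andP[zk zs].
  have {zs} : [&& (0 \in s) || (z.1 == 0), (g \in s) || (coordl x y z.2 == 0)
    & (- g \in s) || (coordr x y z.2 == 0)].
    elim: s {ks IHs} z zs {zk} => [|i s IHs] z.
      rewrite big_nil memv0 => /eqP->.
      by rewrite /coordl /coordr /= !linear0 eqxx.
    rewrite big_cons => /memv_addP[p].
    rewrite (mem_B12_Gamma xy_basis) => /and3P[p0 p1 p2].
    case=> q /IHs/and3P[q0 q1 q2] ->.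
    rewrite !inE /coordl /coordr /= !linearD /=.
    by apply/and3P; split; apply: orb_addr_eq0 => //; rewrite eq_sym.
  have in_zero d (t : F) :
      (k == d) || (t == 0) -> (d \in s) || (t == 0) -> t == 0.
    by case: eqP => [<-|//]; rewrite (negPf ks).
  case/and3P: zk => z0 z1 z2 /and3P[s0 s1 s2].
  apply/eqP; case: z z0 z1 z2 s0 s1 s2 => a w /= z0 z1 z2 s0 s1 s2.
  rewrite (eqP (in_zero _ _ z0 s0)) [w](coord2E xy_basis).
  by rewrite (eqP (in_zero _ _ z1 s1)) (eqP (in_zero _ _ z2 s2)) !scale0r addr0.
- rewrite !(mem_B12_Gamma xy_basis) /= => /and3P[p0 p1 p2] /and3P[q0 q1 q2].
  (* The product of a coordinate living in degree [d] and one living in degree [e] lives in degree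
     [d + e]. *)
  have mul_zero d e f (s t : F) : d + e = f -> (h == d) || (s == 0) ->
      (k == e) || (t == 0) -> (h + k == f) || (s * t == 0).
    move=> <- /orP[]/eqP-> /orP[]/eqP->;
    by rewrite ?mul0r ?mulr0 eqxx ?orbT.
  have mulr_zero (c : bool) (s t : F) : c || (s == 0) -> c || (s * t == 0).
    by case: c => //= /eqP->; rewrite mul0r.
  rewrite (alternating_coord _ _ xy_basis) /coordl /coordr !linearD !linearZ /=.
  (* Each coordinate of the product is a sum of two terms; doubling the boolean with [orbb] lets
     each term be treated separately. *)
  apply/and3P; split; rewrite -[X in X || _]orbb; apply: orb_addr_eq0.
  + by apply: (mul_zero) p0 q0; rewrite addr0.
  + apply: mulr_zero; rewrite -[X in X || _]orbb; apply: orb_addr_eq0.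
      by apply: (mul_zero) p1 q2; rewrite subrr.
    by rewrite oppr_eq0; apply: (mul_zero) p2 q1; rewrite addNr.
  + by apply: (mul_zero) p0 q1; rewrite add0r.
  + by rewrite mulrC; apply: (mul_zero) p1 q0; rewrite addr0.
  + by apply: (mul_zero) p0 q2; rewrite add0r.
  + by rewrite mulrC; apply: (mul_zero) p2 q0; rewrite addr0.
Qed.

End Form.

(** * Degrees of 1 and of odd vectors for any product on F1 + V with parity [B12_part] *)

Section SuperGrading.

Variables (F : fieldType) (V : vectType F).
Local Notation B := (B12_space V).
Local Notation one := (B12_one V).
Local Notation inj := (@B12_inj F V).

Variables (S : superalgebra B) (G : zmodType) (Gam : G -> {vspace B}).
Hypotheses (mainS : main_grading S = B12_part V) (superG : super_grading S Gam).

Lemma super_grading_even (g : G) (z : B) : z \in Gam g -> (z.1, 0) \in Gam g.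
Proof.
by have [_ /(_ g)] := superG; rewrite mainS => /super_subspaceP; apply.
Qed.

Lemma super_grading_odd (g : G) (z : B) : z \in Gam g -> inj z.2 \in Gam g.
Proof.
move=> zg; have -> : inj z.2 = z - (z.1, 0).
  by case: z {zg} => a w; congr pair; rewrite /= ?subrr ?subr0.
by rewrite memvB ?super_grading_even.
Qed.

Lemma super_grading_one : S one one = one -> one \in Gam 0.
Proof.
move=> S11; have [gradG _] := superG; have [_ _ mulG] := gradG.
(* A homogeneous vector outside V has a nonzero even part, of the same degree and proportional to
   1. *)
have [|g [[a w] [/super_grading_even /= zg aw]]] :=
    grading_homogeneous_notin gradG (U := B12_part V 1).
  apply: contraTneq (memvf one) => <-.
  by rewrite mem_B12_part /= oner_eq0.
have a0 : a != 0 by move: aw; rewrite mem_B12_part.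
have oneg : one \in Gam g.
  have -> : one = a^-1 *: (a, 0) :> B.
    by congr pair; rewrite /= ?scaler0 // [RHS]mulVf.
  exact: memvZ.
have := mulG _ _ _ _ oneg oneg; rewrite S11 => one2g.
have one0 : one != 0 by rewrite -pair_eqE /= negb_and oner_eq0.
have := grading_degree_unique gradG one0 oneg one2g.
by rewrite -{1}[g]addr0 => /addrI->.
Qed.

(** Take a homogeneous vector outside the preimage of [U] under the projection to V, and keep its
    odd part. *)
Lemma super_grading_odd_notin (U : {vspace V}) :
  U != fullv -> exists g w, inj w \in Gam g /\ w \notin U.
Proof.
move=> Ufull; have [gradG _] := superG.
pose p : 'Hom(B, V) := linfun snd.
have [|g [z [/super_grading_odd zg zU]]] :=
    grading_homogeneous_notin gradG (U := (p @^-1: U)%VS).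
  apply: contra Ufull => /eqP pU; rewrite eqEsubv subvf; apply/subvP => w _.
  have := memvf (inj w); rewrite -pU -memv_preim.
  by rewrite lfunE.
by exists g, z.2; split=> //; move: zU; rewrite -memv_preim lfunE.
Qed.

(** The product is a nonzero multiple of 1, hence has degree 0 as well as [g + h]. *)
Lemma super_grading_zero_sum (g h : G) (x y : V) (a : F) : S one one = one ->
  inj x \in Gam g -> inj y \in Gam h -> S (inj x) (inj y) = (a, 0) -> a != 0 ->
  g + h = 0.
Proof.
move=> S11 xg yh Sxy a0; have [gradG _] := superG; have [_ _ mulG] := gradG.
have := mulG _ _ _ _ xg yh; rewrite Sxy => a_gh.
have aE : (a, 0) = a *: one :> B.
  by congr pair; rewrite /= ?scaler0 // [RHS]mulr1.
apply: (grading_degree_unique gradG _ a_gh).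
  by rewrite -pair_eqE /= negb_and a0.
by rewrite aE memvZ // super_grading_one.
Qed.

(** The lines spanning Gamma(G, g) lie in the matching components of [Gam], and a grading refining
    another one degree by degree equals it. The product of [S] may differ from that of [B12 b],
    since only subspaces are compared. *)
Lemma super_grading_eq_Gamma (b : {biscalar V}) (g : G) (x y : V) :
  alternating b -> basis_of {:V} [:: x; y] ->
  S one one = one -> inj x \in Gam g -> inj y \in Gam (- g) ->
  forall k, Gam k = B12_Gamma x y g k.
Proof.
move=> b_alt xy S11 xg yg k; have [gradG _] := superG.
have [gradD _] := B12_Gamma_super b_alt xy g.
rewrite (grading_refine_eq gradG gradD) // => {}k.
rewrite !subv_add -andbA; apply/and3P; split; case: eqP => [->|_];
  rewrite ?sub0v // -memvE //.
exact: super_grading_one.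
Qed.

End SuperGrading.

(** * Every grading on B(1,2) comes from a symplectic basis *)

Section B12Theory.

Variables (F : fieldType) (V : vectType F) (b : {biscalar V}).
Hypothesis b_alt : alternating b.
Local Notation B := (B12_space V).
Local Notation one := (B12_one V).
Local Notation inj := (@B12_inj F V).

Lemma B12_mul_odd (x y : V) : B12_mul b (inj x) (inj y) = (b x y, 0).
Proof. by congr pair; rewrite /= ?scale0r ?mul0r ?add0r ?addr0. Qed.

(** Proportional vectors pair to zero under an alternating form. *)
Lemma basis_of_form (x y : V) :
  \dim {:V} = 2%N -> b x y != 0 -> basis_of {:V} [:: x; y].
Proof.
move=> dimV bxy.
rewrite basisEfree subvf dimV /= andbT free_cons seq1_free span_seq1.
apply/andP; split; apply: contraNN bxy; last by move/eqP->; rewrite linear0r.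
by move/vlineP => [a ->]; rewrite linearZl_LR /= b_alt mulr0.
Qed.

Lemma B12_super_gradingE (u v : V) (G : zmodType) (Gam : G -> {vspace B}) :
  basis_of {:V} [:: u; v] -> b u v = 1 ->
  super_grading (B12 b) Gam ->
  exists x y g, [/\ basis_of {:V} [:: x; y], b x y = 1
    & forall k, Gam k = B12_Gamma x y g k].
Proof.
move=> uv buv superG; pose S := B12 b.
have dimV : \dim {:V} = 2%N by rewrite -(size_basis (X := [tuple u; v]) uv).
have line_notfull (w : V) : <[w]>%VS != fullv.
  by apply/eqP => wE; have := dim_vline w; rewrite wE dimV; case: eqP.
have [g [x [xg x0]]] : exists g x, inj x \in Gam g /\ x \notin 0%VS.
  apply: (super_grading_odd_notin (S := S) erefl superG).
  by apply/eqP => zeroE; move: dimV; rewrite -zeroE dimv0.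
have [h [y [yh yx]]] :=
  super_grading_odd_notin (S := S) erefl superG (line_notfull x).
have free_xy : free [:: y; x].
  by rewrite free_cons seq1_free span_seq1 yx -memv0.
have xy : basis_of {:V} [:: x; y].
  by rewrite (perm_basis (Y := [:: y; x])) ?basisEfree ?free_xy ?subvf ?dimV //;
     apply/permP => p /=; rewrite addnCA.
(* By the determinant formula, [b x y = 0] would make [b] vanish identically, against
   [b u v = 1]. *)
have bxy : b x y != 0.
  apply: contraTneq (oner_neq0 F) => bxy.
  by rewrite -buv (alternating_coord b_alt u v xy) bxy mulr0 eqxx.
have gh : g + h = 0.
  have Sxy := B12_mul_odd x y.
  apply: (super_grading_zero_sum (S := S) erefl superG _ xg yh Sxy bxy).
  exact: B12_1l.
have hE : h = - g by apply/eqP; rewrite -addr_eq0 addrC gh.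
pose y' := (b x y)^-1 *: y.
have xy' : basis_of {:V} [:: x; y'].
  apply: basis_of_form => //.
  by rewrite linearZr_LR mulf_eq0 invr_eq0 negb_or bxy.
exists x, y', g; split=> //.
  by rewrite linearZr_LR [LHS]mulVf.
apply: (super_grading_eq_Gamma (S := S) erefl superG b_alt xy') => //.
  exact: B12_1l.
by rewrite -hE /y' linearZ memvZ.
Qed.

End B12Theory.

(** * Isomorphisms from symplectic base changes, and compatibility with the involution *)

Section Iso.

Variables (F : fieldType) (V : vectType F) (b : {biscalar V}).
Local Notation B := (B12_space V).
Local Notation one := (B12_one V).
Local Notation inj := (@B12_inj F V).

Definition B12_change (x y x' y' : V) (z : B) : B :=
  (z.1, coordl x y z.2 *: x' + coordr x y z.2 *: y').

Fact B12_change_is_linear (x y x' y' : V) : linear (B12_change x y x' y').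
Proof.
move=> a z t; congr pair => /=.
rewrite /coordl /coordr !(linearP (coord _ _)) /= !scalerDl -!scalerA scalerDr.
by rewrite addrACA.
Qed.

HB.instance Definition _ (x y x' y' : V) :=
  GRing.isLinear.Build F B B _ (B12_change x y x' y')
    (B12_change_is_linear x y x' y').

Lemma B12_changeK (x y x' y' : V) :
  basis_of {:V} [:: x; y] -> basis_of {:V} [:: x'; y'] ->
  cancel (B12_change x y x' y') (B12_change x' y' x y).
Proof.
move=> xy xy' [a w]; congr pair => /=.
by rewrite !(coord2_free xy') -coord2E.
Qed.

Lemma B12_change_part (x y x' y' : V) (i : 'Z_2) (z : B) :
  z \in B12_part V i -> B12_change x y x' y' z \in B12_part V i.
Proof.
rewrite !mem_B12_part; case: ifP => //= _ /eqP->.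
by rewrite /coordl /coordr !linear0 !scale0r addr0.
Qed.

(** The base change keeps coordinates, and these together with [b x y = b x' y'] determine the form
    through the determinant formula. *)
Lemma symplectic_super_iso (x y x' y' : V) : alternating b ->
  basis_of {:V} [:: x; y] -> basis_of {:V} [:: x'; y'] -> b x y = b x' y' ->
  exists f : 'Hom(B, B), [/\ super_iso (B12 b) (B12 b) f,
    f one = one, f (inj x) = inj x' & f (inj y) = inj y'].
Proof.
move=> b_alt xy xy' bE; pose f := B12_change x y x' y'.
have fK := B12_changeK xy xy'; have Kf := B12_changeK xy' xy.
exists (linfun f); split; first split.
- by exists (B12_change x' y' x y) => z; rewrite lfunE; [apply: fK | apply: Kf].
- move=> z t; rewrite !lfunE; congr pair => /=.
    rewrite (alternating_coord b_alt _ _ xy).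
    rewrite [in RHS](alternating_coord b_alt _ _ xy').
    by rewrite !(coord2_free xy') bE.
  rewrite /coordl /coordr !(linearD (coord _ _)) !(linearZ_LR (coord _ _)) /=.
  rewrite !scalerDl -!scalerA.
  by rewrite !scalerDr addrACA.
- move=> i; apply: subv_anti; apply/andP; split; apply/subvP => z.
    by case/memv_imgP => t ti ->; rewrite lfunE; apply: B12_change_part.
  move=> zi; apply/memv_imgP; exists (B12_change x' y' x y z).
    exact: B12_change_part.
  by rewrite lfunE; apply/esym/Kf.
- rewrite lfunE; congr pair.
  by rewrite /= /coordl /coordr !linear0 !scale0r addr0.
- rewrite lfunE; congr pair => /=.
  by rewrite !(coord2_fst xy) scale1r scale0r addr0.
- rewrite lfunE; congr pair => /=.
  by rewrite !(coord2_snd xy) scale1r scale0r add0r.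
Qed.

Lemma symplectic_isomorphic (x y x' y' : V) (G : zmodType) (g : G) :
  alternating b -> basis_of {:V} [:: x; y] -> basis_of {:V} [:: x'; y'] ->
  b x y = b x' y' ->
  isomorphic_gradings (B12 b) (B12_Gamma x y g) (B12 b) (B12_Gamma x' y' g).
Proof.
move=> b_alt xy xy' bE.
have [f [isof f1 fx fy]] := symplectic_super_iso b_alt xy xy' bE.
exists f => // k; rewrite /B12_Gamma !limgD !limg_if.
by rewrite f1 fx fy.
Qed.

(** The involution is the identity on even vectors and the negation on odd ones, so any
    parity-preserving linear map commutes with it. *)
Lemma B12_super_iso_bar (S T : superalgebra B) (f : 'Hom(B, B)) (z : B) :
  main_grading S = B12_part V -> main_grading T = B12_part V ->
  super_iso S T f -> f (B12_bar z) = B12_bar (f z).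
Proof.
move=> mS mT [_ _ fpart].
have fmem i t : t \in B12_part V i -> f t \in B12_part V i.
  by move=> ti; rewrite -mT -fpart mS memv_img.
have zE : z = (z.1, 0) + inj z.2.
  by case: z => a w; congr pair; rewrite /= ?addr0 ?add0r.
have bzE : B12_bar z = (z.1, 0) - inj z.2.
  by case: {zE} z => a w; congr pair; rewrite /= ?subr0 ?sub0r.
have := fmem 0 (z.1, 0); rewrite !mem_B12_part /= => /(_ (eqxx _))/eqP f0.
have := fmem 1 (inj z.2); rewrite !mem_B12_part /= => /(_ (eqxx _))/eqP f1.
rewrite bzE [in RHS]zE linearB linearD /=.
by congr pair; rewrite /= ?f0 ?f1 ?subr0 ?addr0 ?sub0r ?add0r.
Qed.

Lemma super_grading_bar (S T : superalgebra B)
    (G : zmodType) (Gam : G -> {vspace B}) :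
  main_grading S = B12_part V -> main_grading T = B12_part V ->
  (forall x y, T x y = S (B12_bar x) (B12_bar y)) ->
  super_grading S Gam -> super_grading T Gam.
Proof.
move=> mS mT TE superG; have [[spanG dirG mulG] splitG] := superG.
have bar_mem g z : z \in Gam g -> B12_bar z \in Gam g.
  (* The involution is twice the even projection minus the identity, so it preserves every
     component. *)
  move=> zg; have -> : B12_bar z = (z.1, 0) *+ 2 - z.
    case: z {zg} => a w; rewrite mulr2n.
    by congr pair; rewrite /= ?addrK // addr0 sub0r.
  by rewrite memvB // rpredMn // (super_grading_even mS superG).
split=> [|g]; last by rewrite mT -mS.
by split=> // g h x y xg yh; rewrite TE mulG ?bar_mem.
Qed.

Lemma super_iso_bar (S T : superalgebra B) (f : 'Hom(B, B)) :
  main_grading S = B12_part V -> main_grading T = B12_part V ->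
  (forall x y, T x y = S (B12_bar x) (B12_bar y)) ->
  super_iso S S f -> super_iso T T f.
Proof.
move=> mS mT TE isof; have [fbij fmul fpart] := isof.
split=> // [x y|i]; last by rewrite mT -mS.
by rewrite !TE fmul !(B12_super_iso_bar _ mS mS isof).
Qed.

End Iso.

(** * Comparison of Gamma(G, g) with the main grading and the Z-grading *)

Section GammaTheory.

Variables (F : fieldType) (V : vectType F) (u v : V).
Hypothesis uv : basis_of {:V} [:: u; v].
Local Notation B := (B12_space V).
Local Notation inj := (@B12_inj F V).

Lemma basis2_fst_neq0 : u != 0.
Proof.
apply: contraNneq (oner_neq0 F) => u0.
by have [<- _] := coord2_fst uv; rewrite {2}u0 /coordl linear0.
Qed.

Lemma B12_Gamma_full (G : zmodType) (g : G) :
  B12_Gamma u v g 0 = fullv <-> g = 0.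
Proof.
split=> [gfull | ->].
  have := memvf (inj u); rewrite -gfull (mem_B12_Gamma uv) /= (coord2_fst uv).
  by rewrite oner_eq0 orbF => /and3P[_ /eqP<-].
by apply/vspaceP => z; rewrite memvf (mem_B12_Gamma uv) oppr0 eqxx.
Qed.

(** When [g = - g], both [u] and [v] have degree [g], so the lines they span merge into the whole
    odd part. *)
Lemma B12_Gamma_main (G : zmodType) (g k : G) : g = - g -> g != 0 ->
  B12_Gamma u v g k =
    if k == 0 then B12_part V 0 else if k == g then B12_part V 1 else 0%VS.
Proof.
move=> gN g0; apply/vspaceP => z; rewrite (mem_B12_Gamma uv) -gN.
have w0 w : (coordl u v w == 0) && (coordr u v w == 0) = (w == 0).
  apply/andP/eqP => [[/eqP cl /eqP cr] | ->].
    by rewrite [w](coord2E uv) cl cr !scale0r addr0.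
  by rewrite /coordl /coordr !linear0.
case: (k =P 0) => [->|_].
  by rewrite (eq_sym 0 g) (negPf g0) mem_B12_part w0.
case: (k =P g) => _; first by rewrite mem_B12_part /= andbT.
rewrite /= w0 memv0; case: z => a w /=.
by rewrite -pair_eqE.
Qed.

Lemma B12_Z_gradingE (n : int) :
  B12_Z_grading u v n = B12_Gamma u v (1 : int) n.
Proof.
rewrite /B12_Z_grading /B12_Gamma.
case: eqP => [->|_]; first by rewrite !addv0.
case: eqP => [->|_]; first by rewrite addv0 add0v.
by case: eqP; rewrite ?addv0 ?add0v.
Qed.

(** The pair [(v, - u)] takes the same value under an alternating form as [(u, v)], with the two
    degrees exchanged; this yields the isomorphism between Gamma(G, g) and Gamma(G, -g). *)
Lemma B12_Gamma_swap (G : zmodType) (g k : G) :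
  B12_Gamma v (- u) g k = B12_Gamma u v (- g) k.
Proof.
rewrite /B12_Gamma opprK.
have -> : <[inj (- u)]>%VS = <[inj u]>%VS :> {vspace B}.
  rewrite linearN; apply: subv_anti.
  by rewrite -!memvE memvN memv_line -memvN memv_line.
by rewrite -!addvA; congr (_ + _)%VS; rewrite addvC.
Qed.

Lemma B12_main_super (S : superalgebra B) : main_grading S = B12_part V ->
  super_grading S (main_grading S).
Proof.
move=> mS; split; first exact: main_gradingP.
rewrite mS => i; apply/super_subspaceP => z; rewrite !mem_B12_part.
by case: ifP.
Qed.

Lemma B12_main_nontrivial (S : superalgebra B) : main_grading S = B12_part V ->
  nontrivial_grading S (main_grading S).
Proof.
move=> mS; split; first exact: B12_main_super.
rewrite mS => full0; have := memvf (inj u); rewrite -full0 mem_B12_part /=.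
by rewrite (negPf basis2_fst_neq0).
Qed.

Lemma isomorphic_Gamma_main (S : superalgebra B) (G : zmodType)
    (Gam : G -> {vspace B}) (g : G) :
  main_grading S = B12_part V ->
  isomorphic_gradings S Gam S (B12_Gamma u v g) -> g = - g -> g != 0 ->
  equivalent_gradings S Gam S (main_grading S).
Proof.
move=> mS [f isof fE] gN g0; exists f => // k k0.
(* Injectivity keeps the image nonzero, which rules out every degree other than 0 and [g]. *)
have fk0 : (f @: Gam k)%VS != 0%VS.
  by rewrite -[0%VS](limg0 f) (eq_limg_ker0 _ _ (lker_super_iso isof)).
move: fk0; rewrite fE B12_Gamma_main // mS.
case: (k =P 0) => _; first by exists 0.
by case: (k =P g) => _; [exists 1 | rewrite eqxx].
Qed.

(** If [g != - g], then 0, g and -g are pairwise distinct and the nonzero components are exactly the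
    three lines of the Z-grading. *)
Lemma isomorphic_Gamma_Z (S : superalgebra B) (G : zmodType)
    (Gam : G -> {vspace B}) (g : G) :
  isomorphic_gradings S Gam S (B12_Gamma u v g) -> g != - g ->
  equivalent_gradings S Gam S (B12_Z_grading u v).
Proof.
move=> [f isof fE] gN; exists f => // k k0.
have g0 : g != 0 by apply: contraNneq gN => ->; rewrite oppr0.
have fk0 : (f @: Gam k)%VS != 0%VS.
  by rewrite -[0%VS](limg0 f) (eq_limg_ker0 _ _ (lker_super_iso isof)).
move: fk0; rewrite fE /B12_Gamma.
have [->|_] := eqVneq k 0.
  rewrite !(eq_sym 0) (negPf g0) oppr_eq0 (negPf g0) !addv0.
  by exists 0.
have [->|_] := eqVneq k g.
  by rewrite (negPf gN) addv0 add0v; exists 1.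
case: (k =P - g) => _; last by rewrite !addv0 eqxx.
by rewrite !add0v; exists (-1).
Qed.

Lemma nontrivial_isomorphic_Gamma (S : superalgebra B) (G : zmodType)
    (Gam : G -> {vspace B}) (g : G) :
  nontrivial_grading S Gam ->
  isomorphic_gradings S Gam S (B12_Gamma u v g) -> g != 0.
Proof.
move=> [_ Gam0] [f isof fE]; apply/eqP => /B12_Gamma_full full0; apply: Gam0.
apply/eqP; rewrite -(eq_limg_ker0 _ _ (lker_super_iso isof)) fE full0.
by rewrite lker0_limgf // (lker_super_iso isof).
Qed.

(** The image of [u] is a nonzero odd vector of degree [g] in the target, where odd vectors occur
    only in degrees [h] and [- h]. *)
Lemma Gamma_isomorphic_degree (S : superalgebra B) (G : zmodType) (g h : G) :
  main_grading S = B12_part V ->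
  isomorphic_gradings S (B12_Gamma u v g) S (B12_Gamma u v h) ->
  g = h \/ g = - h.
Proof.
move=> mS [f isof fE]; have [fbij _ fpart] := isof.
have ug : inj u \in B12_Gamma u v g g.
  by rewrite (mem_B12_Gamma uv) /= !eqxx !(coord2_fst uv) eqxx !orbT.
have fu1 : f (inj u) \in B12_part V 1.
  by rewrite -mS -fpart mS memv_img // mem_B12_part /=.
have := memv_img f ug; rewrite fE (mem_B12_Gamma uv) => /and3P[_].
case: eqP => [->|_ /= /eqP cl]; first by left.
case: eqP => [->|_ /= /eqP cr]; first by right.
have fu0 : f (inj u) = 0.
  move: fu1 cl cr; case: (f _) => a w; rewrite mem_B12_part /= => /eqP-> cl cr.
  by rewrite [w](coord2E uv) cl cr !scale0r addr0.
have /(congr1 (fun z => coordl u v z.2)) : inj u = 0.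
  by apply: (bij_inj fbij); rewrite fu0 linear0.
by rewrite /= (coord2_fst uv) /coordl linear0 => /eqP; rewrite oner_eq0.
Qed.

(** An isomorphism preserves the main components, so the line of [u] would be one of them: not the
    even part, as [u] is odd, nor the odd part, which also contains [v]. *)
Lemma Z_grading_not_equivalent_main (S : superalgebra B) :
  main_grading S = B12_part V ->
  ~ equivalent_gradings S (B12_Z_grading u v) S (main_grading S).
Proof.
move=> mS [f isof /(_ 1)]; rewrite /B12_Z_grading /=.
have one0 := oner_neq0 F.
case=> [|i].
  apply: contraNneq one0 => u0; have := memv_line (inj u).
  rewrite u0 memv0 => /eqP/(congr1 (fun z => coordl u v z.2)).
  by rewrite /= (coord2_fst uv) /coordl linear0 => ->.
have [_ _ <-] := isof; rewrite mS => /eqP.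
rewrite (eq_limg_ker0 _ _ (lker_super_iso isof)) => /eqP lineE.
have := memv_line (inj u); rewrite lineE mem_B12_part.
case: eqP => [_ /eqP/(congr1 (coordl u v)) | i0 _].
  by rewrite /= (coord2_fst uv) /coordl linear0 => /eqP; rewrite oner_eq0.
have : inj v \in <[inj u]>%VS by rewrite lineE mem_B12_part; case: eqP.
case/vlineP => a /(congr1 (fun z => coordr u v z.2)) /=.
rewrite (coord2_snd uv) /coordr linearZ /= -/(coordr u v u) (coord2_fst uv).
by rewrite mulr0 => /eqP; rewrite oner_eq0.
Qed.

End GammaTheory.

(** * The twisted product, and its gradings for nonzero lambda *)

Section TwistedTheory.

Variables (F : fieldType) (V : vectType F) (b : {biscalar V}).
Variables (u v : V) (lam : F).
Hypotheses (uv : basis_of {:V} [:: u; v]) (b_alt : alternating b).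
Local Notation B := (B12_space V).
Local Notation one := (B12_one V).
Local Notation inj := (@B12_inj F V).

(** In this form phi is a transvection along [u]: it keeps the v-coordinate, so applying it twice
    adds the same multiple of [u] twice. *)
Lemma B12_phiE (z : B) :
  B12_phi u v lam z = (z.1, z.2 + (lam * coordr u v z.2) *: u).
Proof.
congr pair; rewrite [X in _ = X + _](coord2E uv z.2) scalerDr scalerA mulrC.
by rewrite -!addrA; congr (_ + _); rewrite addrC.
Qed.

Lemma B12bar_11 : B12bar b u v lam one one = one.
Proof.
have bar1 : B12_bar one = one by rewrite /B12_bar /= oppr0.
have phi1 : B12_phi u v lam one = one.
  by rewrite B12_phiE /= /coordr linear0 mulr0 scale0r addr0.
by rewrite /= /B12bar_mul bar1 !phi1 B12_1l.
Qed.

Lemma B12bar_1l (w : V) :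
  B12bar b u v lam one (inj w) =
  - inj (w + (2 * lam * coordr u v w) *: u).
Proof.
have bar1 : B12_bar one = one by rewrite /B12_bar /= oppr0.
have phi1 : B12_phi u v lam one = one.
  by rewrite B12_phiE /= /coordr linear0 mulr0 scale0r addr0.
rewrite /= /B12bar_mul bar1 phi1 B12_1l.
have -> : B12_bar (inj w) = - inj w by congr pair; rewrite /= oppr0.
rewrite !linearN /=; congr (- _).
rewrite !B12_phiE /=; congr pair.
rewrite /coordr !(linearD (coord _ _)) !(linearZ_LR (coord _ _)) /=.
rewrite -/(coordr u v u) (coord2_fst uv) mulr0 addr0 -addrA -scalerDl.
by rewrite -mulrA mulr_natl mulr2n.
Qed.

(** The two signs cancel, and the multiple of [u] added to [v] pairs to zero with [u]. *)
Lemma B12bar_uv : B12bar b u v lam (inj u) (inj v) = (b u v, 0).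
Proof.
have barN w : B12_bar (inj w) = inj (- w) by congr pair; rewrite /= ?oppr0.
rewrite /= /B12bar_mul !barN !B12_phiE B12_mul_odd /=.
rewrite /coordr !(linearD (coord _ _)) !(linearZ_LR (coord _ _)) /=.
rewrite -/(coordr u v u) (coord2_fst uv).
rewrite (linearN (coord _ _)) /= -/(coordr u v u) (coord2_fst uv).
rewrite oppr0 !mulr0 scale0r !addr0.
rewrite -addrA -scalerDl linearDr linearZr_LR linearNl linearNr opprK.
by rewrite linearNl b_alt oppr0 mulr0 addr0.
Qed.

Lemma B12bar_super_gradingE (G : zmodType) (Gam : G -> {vspace B}) :
  (2 : F) != 0 -> lam != 0 -> b u v = 1 ->
  super_grading (B12bar b u v lam) Gam ->
  exists2 g : G, g = - g & forall k, Gam k = B12_Gamma u v g k.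
Proof.
move=> two0 lam0 buv superG; have [[_ _ mulG] _] := superG.
pose S := B12bar b u v lam.
have [|g [w [wg wu]]] :=
    super_grading_odd_notin (S := S) erefl superG (U := <[u]>%VS).
  apply/eqP => full_u; have /vlineP[a] : v \in <[u]>%VS by rewrite full_u memvf.
  move/(congr1 (coordr u v)); rewrite (coord2_snd uv) /coordr linearZ /=.
  by rewrite -/(coordr u v u) (coord2_fst uv) mulr0 => /eqP; rewrite oner_eq0.
have cw : coordr u v w != 0.
  apply: contraNneq wu => cw; rewrite [w](coord2E uv) cw scale0r addr0.
  by rewrite memvZ ?memv_line.
have one0 := super_grading_one (S := S) erefl superG B12bar_11.
have ug : inj u \in Gam g.
  have := mulG _ _ _ _ one0 wg; rewrite add0r B12bar_1l memvN linearD /= => swg.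
  (* Comparing the product of 1 and [w] with [w] isolates a multiple of [u], whose coefficient is a
     product of nonzero scalars. *)
  have : inj ((2 * lam * coordr u v w) *: u) \in Gam g.
    by rewrite -[X in X \in _](addKr (inj w)) memvD ?memvN.
  rewrite linearZ /= => /(memvZ (2 * lam * coordr u v w)^-1).
  by rewrite scalerA mulVf ?scale1r // !mulf_neq0.
have vg : inj v \in Gam g.
  have -> : v = (coordr u v w)^-1 *: (w - coordl u v w *: u).
    by rewrite [X in X - _](coord2E uv) addrC addKr scalerA mulVf ?scale1r.
  by rewrite linearZ linearB linearZ /= memvZ // memvB // memvZ.
have gg : g + g = 0.
  apply: (super_grading_zero_sum (S := S) erefl superG B12bar_11 ug vg).
    exact: B12bar_uv.
  by rewrite buv oner_neq0.
have gN : g = - g by apply/eqP; rewrite -addr_eq0 gg.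
exists g => //.
apply: (super_grading_eq_Gamma (S := S) erefl superG b_alt uv) => //.
  exact: B12bar_11.
by rewrite -gN.
Qed.

End TwistedTheory.

(** * Transfer between B(1,2) and its twist at lambda zero *)

Section Untwisted.

Variables (F : fieldType) (V : vectType F) (b : {biscalar V}) (u v : V).
Hypotheses (uv : basis_of {:V} [:: u; v]).
Local Notation B := (B12 b).
Local Notation S := (B12bar b u v 0).

Lemma B12bar0E (x y : B12_space V) : S x y = B (B12_bar x) (B12_bar y).
Proof.
have phi0 z : B12_phi u v 0 z = z.
  by rewrite (B12_phiE 0 uv) mul0r scale0r addr0; case: z.
by rewrite /= /B12bar_mul !phi0.
Qed.

(** The involution squares to the identity, so the relation between the two products is symmetric
    and transfers run both ways. *)
Lemma B12_bar0E (x y : B12_space V) : B x y = S (B12_bar x) (B12_bar y).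
Proof.
have barK z : B12_bar (B12_bar z) = z :> B12_space V.
  by case: z => a w; congr pair; rewrite /= opprK.
by rewrite B12bar0E !barK.
Qed.

Lemma super_grading_bar0 (G : zmodType) (Gam : G -> {vspace B12_space V}) :
  super_grading S Gam <-> super_grading B Gam.
Proof.
by split; [apply: (super_grading_bar _ _ B12_bar0E)
          | apply: (super_grading_bar _ _ B12bar0E)].
Qed.

Lemma super_iso_bar0 (f : 'Hom(B12_space V, B12_space V)) :
  super_iso S S f <-> super_iso B B f.
Proof.
by split; [apply: (super_iso_bar _ _ B12_bar0E)
          | apply: (super_iso_bar _ _ B12bar0E)].
Qed.

Lemma isomorphic_gradings_bar0 (G : zmodType)
    (Gam Del : G -> {vspace B12_space V}) :
  isomorphic_gradings S Gam S Del <-> isomorphic_gradings B Gam B Del.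
Proof. by split=> -[f /super_iso_bar0 isof fE]; exists f. Qed.

Lemma equivalent_gradings_bar0 (G H : zmodType)
    (Gam : G -> {vspace B12_space V}) (Del : H -> {vspace B12_space V}) :
  equivalent_gradings S Gam S Del <-> equivalent_gradings B Gam B Del.
Proof. by split=> -[f /super_iso_bar0 isof fE]; exists f. Qed.

End Untwisted.

(** * The classification in the two cases for lambda *)

Theorem theorem33 (F : fieldType) (V : vectType F) (b : {biscalar V})
    (u v : V) (lam : F) :
  3%N \in [pchar F] ->
  \dim {:V} = 2%N -> alternating b -> nondegenerate_form b ->
  basis_of {:V} [:: u; v] -> b u v = 1 ->
  let B := B12 b in
  let S := B12bar b u v lam in
  (lam = 0 ->
    [/\ forall (G : zmodType) (Gam : G -> {vspace B12_space V}),
          nontrivial_grading S Gam <-> nontrivial_grading B Gam,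
        forall (G H : zmodType) (Gam : G -> {vspace B12_space V})
            (Del : H -> {vspace B12_space V}),
          nontrivial_grading S Gam -> nontrivial_grading S Del ->
          (equivalent_gradings S Gam S Del <->
           equivalent_gradings B Gam B Del),
        forall (G : zmodType) (Gam Del : G -> {vspace B12_space V}),
          nontrivial_grading S Gam -> nontrivial_grading S Del ->
          (isomorphic_gradings S Gam S Del <->
           isomorphic_gradings B Gam B Del),
        [/\ nontrivial_grading S (B12_Z_grading u v),
            nontrivial_grading S (main_grading S),
            ~ equivalent_gradings S (B12_Z_grading u v) S (main_grading S)
          & forall (G : zmodType) (Gam : G -> {vspace B12_space V}),
              nontrivial_grading S Gam ->
              equivalent_gradings S Gam S (B12_Z_grading u v) \/
              equivalent_gradings S Gam S (main_grading S)]
      & forall G : zmodType,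
        [/\ forall g : G, super_grading S (B12_Gamma u v g),
            forall Gam : G -> {vspace B12_space V}, super_grading S Gam ->
              exists g : G, isomorphic_gradings S Gam S (B12_Gamma u v g)
          & forall g h : G,
              isomorphic_gradings S (B12_Gamma u v g) S (B12_Gamma u v h) <->
              (g = h \/ g = - h)]]) /\
  (lam <> 0 ->
    [/\ nontrivial_grading S (main_grading S),
        forall (G : zmodType) (Gam : G -> {vspace B12_space V}),
          nontrivial_grading S Gam ->
          equivalent_gradings S Gam S (main_grading S)
      & forall (G : zmodType) (Gam Del : G -> {vspace B12_space V}),
          nontrivial_grading S Gam -> nontrivial_grading S Del ->
          (isomorphic_gradings S Gam S Del <-> same_support Gam Del)]).
Proof.
move=> char3 dimV b_alt _ uv buv B S.
have mS : main_grading S = B12_part V by [].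
have main_nt : nontrivial_grading S (main_grading S).
  exact: B12_main_nontrivial uv _ _.
split=> [lam0 | /eqP lam0].
  rewrite {}/S lam0 {lam0} in mS main_nt *; set S := B12bar b u v 0.
  have GammaP (G : zmodType) (Gam : G -> {vspace B12_space V}) :
      super_grading S Gam ->
      exists g : G, isomorphic_gradings S Gam S (B12_Gamma u v g).
    move=> /(super_grading_bar0 _ uv) superG.
    have [x [y [g [xy bxy GamE]]]] := B12_super_gradingE b_alt uv buv superG.
    exists g; apply/(isomorphic_gradings_bar0 _ uv).
    (* Both bases have form value 1, so the adapted basis [(x, y)] can be moved to the fixed
       [(u, v)] without changing degrees. *)
    have [|f isof fE] := symplectic_isomorphic g b_alt xy uv.
      by rewrite bxy.
    by exists f => // k; rewrite GamE.
  have Gamma_super (G : zmodType) (g : G) : super_grading S (B12_Gamma u v g).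
    exact/(super_grading_bar0 _ uv)/B12_Gamma_super.
  split=> [G Gam | G H Gam Del _ _ | G Gam Del _ _ | | G].
  - by split=> -[/(super_grading_bar0 _ uv) ? ?]; split.
  - exact: equivalent_gradings_bar0.
  - exact: isomorphic_gradings_bar0.
  - split=> // [||G Gam ntG].
    + split; last by rewrite B12_Z_gradingE => /(B12_Gamma_full uv).
      apply: eq_super_grading (Gamma_super int 1) => n.
      by rewrite B12_Z_gradingE.
    + exact: Z_grading_not_equivalent_main.
    + have [g isoG] := GammaP _ _ ntG.1.
      have g0 := nontrivial_isomorphic_Gamma uv ntG isoG.
      (* Equality of [g] and [- g] decides between the main grading and the Z-grading. *)
      have [gN|gN] := eqVneq g (- g).
        by right; apply: isomorphic_Gamma_main isoG _ _.
      by left; apply: isomorphic_Gamma_Z isoG _.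
  - split=> // [|g h]; first exact: GammaP.
    split=> [|[->|->]]; first exact: Gamma_isomorphic_degree.
      exact: eq_isomorphic_gradings.
    apply/(isomorphic_gradings_bar0 _ uv).
    have bvu : b v (- u) = 1 by rewrite linearNr (alternating_anti b_alt) opprK.
    have vu : basis_of {:V} [:: v; - u].
      by apply: (basis_of_form b_alt) => //; rewrite bvu oner_neq0.
    have [|f isof fE] := symplectic_isomorphic (- h) b_alt uv vu.
      by rewrite buv bvu.
    by exists f => // k; rewrite fE B12_Gamma_swap opprK.
(* In characteristic 3, [2 = 0] would give [1 = 0]. *)
have two0 : (2 : F) != 0.
  apply: contraNneq (oner_neq0 F) => two0.
  by have := pcharf0 char3; rewrite -[3%N]addn1 natrD two0 add0r => /eqP.
have GammaP (G : zmodType) (Gam : G -> {vspace B12_space V}) :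
    nontrivial_grading S Gam ->
    exists g : G, [/\ g = - g, g != 0 & forall k, Gam k = B12_Gamma u v g k].
  move=> ntG; have [g gN GamE] :=
    B12bar_super_gradingE uv b_alt two0 lam0 buv ntG.1.
  exists g; split=> //; apply: (nontrivial_isomorphic_Gamma uv ntG).
  exact: eq_isomorphic_gradings.
split=> // [G Gam /GammaP[g [gN g0 GamE]] | G Gam Del].
  apply: (isomorphic_Gamma_main uv) gN g0 => //.
  exact: eq_isomorphic_gradings.
move=> /GammaP[g [gN g0 GamE]] /GammaP[h [hN h0 DelE]].
split=> [[f isof fE] k | supp].
  rewrite -fE -[0%VS in X in _ <-> X](limg0 f).
  by rewrite (eq_limg_ker0 _ _ (lker_super_iso isof)).
(* The supports are [{0, g}] and [{0, h}] with [g] and [h] nonzero, so equal supports force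
   [g = h]. *)
suff gh : g = h by apply: eq_isomorphic_gradings => k; rewrite GamE DelE gh.
have Gg0 : Gam g != 0%VS.
  rewrite GamE; apply: contraNneq (basis2_fst_neq0 uv) => Gg0.
  have : B12_inj u \in B12_Gamma u v g g.
    by rewrite (B12_Gamma_main uv _ gN g0) (negPf g0) eqxx mem_B12_part /=.
  by rewrite Gg0 memv0 -pair_eqE => /andP[].
have := (supp g).1 Gg0; rewrite DelE (B12_Gamma_main uv _ hN h0) (negPf g0).
by case: (g =P h) => // _; rewrite eqxx.
Qed.
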